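(* Assume complete and bounded recourse: for any $\bm v\in\mathbb R^{n_f}$ there exists $\bm y\in\mathbb R^{n_y}$ with $\bm B\bm y\ge\bm v$, and there is no $\bm y\in\mathbb R^{n_y}$ with $\bm B\bm y\ge\bm 0$ and $\bm d^\top\bm y<0$. Then $\bar{\mathcal Y}_P\subseteq\bar{\mathcal Y}_D$, where $$\bar{\mathcal Y}_P=\left\{(\bm x,\upsilon,k)\in\mathcal X\times\mathbb R\times\mathbb R_+\ \left|\ \begin{array}{ll}\exists\,\bm q\in\mathbb R^{n_y},\ \bm Q\in\mathbb R^{n_y\times n_z},\ \bm q^\dag\in\mathbb R^{n_y}:\\ \bm c^\top\bm x+\bm d^\top(\bm q+\bm Q\bm z+\bm q^\dag\|\bm z\|_1)-k\|\bm z\|_1\le\upsilon&\forall\bm z\in\mathcal Z\\ \bm B(\bm q+\bm Q\bm z+\bm q^\dag\|\bm z\|_1)\ge\bm f(\bm x)+\bm F(\bm x)\bm z&\forall\bm z\in\mathcal Z\\ k-\bm d^\top\bm q^\dag\ge0,\ \ \bm B\bm q^\dag\ge\bm 0\end{array}\right.\right\}$$ and $$\bar{\mathcal Y}_D=\left\{(\bm x,\upsilon,k)\in\mathcal X\times\mathbb R\times\mathbb R_+\ \left|\ \begin{array}{ll}\exists\,\bm\pi\in\mathbb R^{n_h},\ \bm\Pi\in\mathbb R^{n_h\times n_f}:\\ \bm c^\top\bm x+\bm\rho^\top\bm f(\bm x)+(\bm\pi+\bm\Pi\bm\rho)^\top\bm h\le\upsilon&\forall\bm\rho\in\mathcal P\\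 -k\bm 1\le\bm H^\top(\bm\pi+\bm\Pi\bm\rho)-\bm F(\bm x)^\top\bm\rho\le k\bm 1&\forall\bm\rho\in\mathcal P\\ \bm\pi+\bm\Pi\bm\rho\ge\bm 0&\forall\bm\rho\in\mathcal P\end{array}\right.\right\},$$ with $\mathcal P=\{\bm\rho\in\mathbb R^{n_f}_+:\bm B^\top\bm\rho=\bm d\}$.
   Context: $\mathcal X\subseteq\mathbb R^{n_x}$; $\bm c\in\mathbb R^{n_x}$, $\bm d\in\mathbb R^{n_y}$, $\bm B\in\mathbb R^{n_f\times n_y}$; $\bm f:\mathbb R^{n_x}\to\mathbb R^{n_f}$ and $\bm F:\mathbb R^{n_x}\to\mathbb R^{n_f\times n_z}$ are affine maps; $\mathcal Z=\{\bm z\in\mathbb R^{n_z}:\bm H\bm z\le\bm h\}$ with $\bm H\in\mathbb R^{n_h\times n_z}$ and $\bm h\in\mathbb R^{n_h}_+$. $\bm 1$ is the all-ones vector and vector inequalities are componentwise. *)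

(* Defs.v *)
From HB Require Import structures.
From mathcomp Require Import all_boot all_order all_algebra.
From mathcomp Require Import boolp classical_sets reals.

Set Implicit Arguments.
Unset Strict Implicit.
Unset Printing Implicit Defensive.

Import Order.TTheory GRing.Theory Num.Theory.
Local Open Scope classical_set_scope.
Local Open Scope ring_scope.

Section Defs.
Context {R : realType}.

Definition is_affine (V W : lmodType R) (g : V -> W) : Prop :=
  exists (L : {linear V -> W}) (b : W), forall x, g x = L x + b.

Definition lev n (u v : 'cV[R]_n) : Prop := forall i, u i 0 <= v i 0.

Definition dotv n (u v : 'cV[R]_n) : R := (u^T *m v) 0 0.

(* The norm that MathComp-Analysis puts on matrices is the max norm. *)
Definition norm1 n (z : 'cV[R]_n) : R := \sum_i `|z i 0|.

Definition complete_recourse nf ny (B : 'M[R]_(nf, ny)) : Prop :=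
  forall v : 'cV[R]_nf, exists y : 'cV[R]_ny, lev v (B *m y).

Definition bounded_recourse nf ny (B : 'M[R]_(nf, ny)) (d : 'cV[R]_ny) : Prop :=
  ~ exists y : 'cV[R]_ny, lev 0 (B *m y) /\ dotv d y < 0.

Definition Zset nh nz (H : 'M[R]_(nh, nz)) (h : 'cV[R]_nh) : set 'cV[R]_nz :=
  [set z | lev (H *m z) h].

Definition Pset nf ny (B : 'M[R]_(nf, ny)) (d : 'cV[R]_ny) : set 'cV[R]_nf :=
  [set rho | lev 0 rho /\ B^T *m rho = d].

Definition YbarP nx ny nf nz nh (X : set 'cV[R]_nx)
    (c : 'cV[R]_nx) (d : 'cV[R]_ny) (B : 'M[R]_(nf, ny))
    (f : 'cV[R]_nx -> 'cV[R]_nf) (F : 'cV[R]_nx -> 'M[R]_(nf, nz))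
    (H : 'M[R]_(nh, nz)) (h : 'cV[R]_nh) : set ('cV[R]_nx * R * R) :=
  [set p | let: (x, v, k) := p in
    [/\ X x, 0 <= k &
     exists (q : 'cV[R]_ny) (Q : 'M[R]_(ny, nz)) (qd : 'cV[R]_ny),
     [/\ forall z, Zset H h z ->
           dotv c x + dotv d (q + Q *m z + norm1 z *: qd) - k * norm1 z <= v,
         forall z, Zset H h z ->
           lev (f x + F x *m z) (B *m (q + Q *m z + norm1 z *: qd)),
         0 <= k - dotv d qd &
         lev 0 (B *m qd)]]].

Definition YbarD nx ny nf nz nh (X : set 'cV[R]_nx)
    (c : 'cV[R]_nx) (d : 'cV[R]_ny) (B : 'M[R]_(nf, ny))
    (f : 'cV[R]_nx -> 'cV[R]_nf) (F : 'cV[R]_nx -> 'M[R]_(nf, nz))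
    (H : 'M[R]_(nh, nz)) (h : 'cV[R]_nh) : set ('cV[R]_nx * R * R) :=
  [set p | let: (x, v, k) := p in
    [/\ X x, 0 <= k &
     exists (pi : 'cV[R]_nh) (Pi : 'M[R]_(nh, nf)),
     [/\ forall rho, Pset B d rho ->
           dotv c x + dotv rho (f x) + dotv (pi + Pi *m rho) h <= v,
         forall rho, Pset B d rho ->
           let w := H^T *m (pi + Pi *m rho) - (F x)^T *m rho in
           lev (const_mx (- k)) w /\ lev w (const_mx k) &
         forall rho, Pset B d rho -> lev 0 (pi + Pi *m rho)]]].

End Defs.

(* Main.v *)
Require Import Defs.
From HB Require Import structures.
From mathcomp Require Import all_boot all_order all_algebra.
From mathcomp Require Import ring lra.
From mathcomp Require Import boolp classical_sets reals.

(** Fix [x] and a primal certificate [(q, Q, qd)].  The cost inequality and each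
    row of the recourse inequality have the same shape: a linear form in [z]
    minus a nonnegative multiple of the 1-norm of [z] is bounded on the
    polyhedron [Zset H h].  Bounding the 1-norm by the sum of auxiliary variables
    turns such a statement into a bounded linear program, so linear programming
    duality ([norm1_lp_duality]) replaces it by a multiplier: a nonnegative
    vector [p] with [dotv p h] at most the bound and with [H^T *m p] close, in
    the max norm, to the linear form.  The multiplier of the cost inequality is
    [pi]; the multipliers of the rows of the recourse inequality are the columns
    of [Pi].

    For [rho] in [Pset B d], adding to the certificate of the cost inequality those of
    the rows weighted by [rho] gives the dual inequalities.  Because
    [B^T *m rho = d], the contributions of [q], [Q] and [qd] cancel: the bounds
    [- dotv d q] and [dotv rho (B *m q)], the forms [Q^T *m d] and
    [(B *m Q)^T *m rho], and the tolerances [k - dotv d qd] and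
    [dotv rho (B *m qd)], which leaves exactly [k].

    Duality rests on the homogeneous Farkas lemma ([farkas]), which is proved by
    a purely algebraic induction on the number of inequalities. *)

Set Implicit Arguments.
Unset Strict Implicit.
Unset Printing Implicit Defensive.

Import Order.TTheory GRing.Theory Num.Theory.
Local Open Scope classical_set_scope.
Local Open Scope ring_scope.

(** * The dot product and the componentwise order *)

Lemma dotvE (R : realType) n (u v : 'cV[R]_n) :
  dotv u v = \sum_i u i 0 * v i 0.
Proof. by rewrite /dotv mxE; apply: eq_bigr => i _; rewrite mxE. Qed.

Lemma dotvC (R : realType) n (u v : 'cV[R]_n) : dotv u v = dotv v u.
Proof. by rewrite !dotvE; apply: eq_bigr => i _; rewrite mulrC. Qed.

Lemma dotvDr (R : realType) n (u v w : 'cV[R]_n) :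
  dotv u (v + w) = dotv u v + dotv u w.
Proof. by rewrite /dotv mulmxDr mxE. Qed.

Lemma dotvBr (R : realType) n (u v w : 'cV[R]_n) :
  dotv u (v - w) = dotv u v - dotv u w.
Proof. by rewrite /dotv mulmxBr !mxE. Qed.

Lemma dotvZr (R : realType) n (u v : 'cV[R]_n) a :
  dotv u (a *: v) = a * dotv u v.
Proof. by rewrite /dotv -scalemxAr mxE. Qed.

Lemma dotvDl (R : realType) n (u v w : 'cV[R]_n) :
  dotv (v + w) u = dotv v u + dotv w u.
Proof. by rewrite dotvC dotvDr !(dotvC u). Qed.

Lemma dotvBl (R : realType) n (u v w : 'cV[R]_n) :
  dotv (v - w) u = dotv v u - dotv w u.
Proof. by rewrite dotvC dotvBr !(dotvC u). Qed.

Lemma dotvZl (R : realType) n (u v : 'cV[R]_n) a :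
  dotv (a *: v) u = a * dotv v u.
Proof. by rewrite dotvC dotvZr (dotvC u). Qed.

Lemma dotv_mulmx (R : realType) m n (A : 'M[R]_(m, n)) u v :
  dotv u (A *m v) = dotv (A^T *m u) v.
Proof. by rewrite /dotv trmx_mul trmxK mulmxA. Qed.

Lemma dotv_col_mx (R : realType) m n (u1 v1 : 'cV[R]_m) (u2 v2 : 'cV[R]_n) :
  dotv (col_mx u1 u2) (col_mx v1 v2) = dotv u1 v1 + dotv u2 v2.
Proof. by rewrite /dotv tr_col_mx mul_row_col mxE. Qed.

Lemma dotv_row (R : realType) m n (A : 'M[R]_(m, n)) v i :
  (A *m v) i 0 = dotv (row i A)^T v.
Proof. by rewrite /dotv trmxK -row_mul [RHS]mxE. Qed.

Lemma lev_dotv (R : realType) n (u v w : 'cV[R]_n) :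
  lev 0 u -> lev v w -> dotv u v <= dotv u w.
Proof.
move=> u0 vw; rewrite !dotvE; apply: ler_sum => i _.
by apply: ler_wpM2l => //; have := u0 i; rewrite mxE.
Qed.

Lemma lev_col_mx (R : realType) m n (u1 v1 : 'cV[R]_m) (u2 v2 : 'cV[R]_n) :
  lev (col_mx u1 u2) (col_mx v1 v2) <-> lev u1 v1 /\ lev u2 v2.
Proof.
split=> [le12|[le1 le2] i].
  split=> i; first by have := le12 (lshift n i); rewrite !col_mxEu.
  by have := le12 (rshift m i); rewrite !col_mxEd.
by case: (split_ordP i) => j ->; rewrite ?col_mxEu ?col_mxEd.
Qed.

Lemma lev_col_mx0 (R : realType) m n (u1 : 'cV[R]_m) (u2 : 'cV[R]_n) :
  lev (col_mx u1 u2) 0 <-> lev u1 0 /\ lev u2 0.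
Proof. by rewrite -lev_col_mx col_mx0. Qed.

Lemma lev_0col_mx (R : realType) m n (u1 : 'cV[R]_m) (u2 : 'cV[R]_n) :
  lev 0 (col_mx u1 u2) <-> lev 0 u1 /\ lev 0 u2.
Proof. by rewrite -lev_col_mx col_mx0. Qed.

(** * Farkas lemmas *)

(** Induction on the number [m] of inequalities.  If the last [m] inequalities
    do not suffice, some [x0] satisfies them and violates the conclusion, hence
    violates the first one, [a].  Projecting every inequality along [x0] onto
    the hyperplane where [a] vanishes gives an instance with [m] inequalities,
    and [x0] also shows that the coefficient of [a] is nonnegative. *)
Lemma farkas (R : realType) m n (A : 'M[R]_(m, n)) (b : 'cV[R]_n) :
  (forall x, lev (A *m x) 0 -> dotv b x <= 0) ->
  exists2 y, lev 0 y & A^T *m y = b.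
Proof.
elim: m A b => [|m IHm] A b Ab.
  (* Without inequalities [b] itself can be tested: its square is [<= 0]. *)
  exists 0 => [[]//|]; rewrite mulmx0; apply/esym/matrixP => i j.
  have /Ab : lev (A *m b) 0 by case.
  rewrite dotvE ord1 mxE => sum_le0.
  have sq_ge0 k : true -> 0 <= b k 0 * b k 0 by rewrite -expr2 sqr_ge0.
  have sum0 : \sum_k b k 0 * b k 0 = 0.
    by apply/eqP; rewrite eq_le sum_le0 sumr_ge0.
  move/eqP: sum0; rewrite psumr_eq0 // => /allP/(_ i).
  by rewrite mem_index_enum mulf_eq0 orbb => /(_ isT)/eqP.
have {A Ab} [a [A1 [-> Ab]]] : exists a (A1 : 'M[R]_(m, n)),
    A = col_mx a^T A1 :> 'M_(1 + m, n) /\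
    forall x, lev (A1 *m x) 0 -> dotv a x <= 0 -> dotv b x <= 0.
  exists (usubmx (A : 'M_(1 + m, n)))^T, (dsubmx (A : 'M_(1 + m, n))).
  rewrite trmxK vsubmxK; split=> // x A1x ax; apply: Ab.
  rewrite -[A](@vsubmxK _ 1 m) (@mul_col_mx _ 1 m).
  apply/(@lev_col_mx0 _ 1 m); split=> // i.
  by rewrite ord1 [X in _ <= X]mxE -[usubmx _]trmxK.
case: (pselect (forall x, lev (A1 *m x) 0 -> dotv b x <= 0)) => [/IHm|].
  move=> [y y0 yE]; exists (col_mx (0 : 'cV_1) y).
    by apply/(@lev_0col_mx _ 1 m); split=> [i|//]; rewrite lexx.
  by rewrite (@tr_col_mx _ 1 m) (@mul_row_col _ n 1 m) mulmx0 add0r.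
move=> /existsNP[x0 /not_implyP[A1x0 /negP]]; rewrite -ltNge => bx0.
have ax0 : 0 < dotv a x0 by rewrite ltNge; apply/negP => /(Ab _ A1x0); lra.
set s := dotv a x0 in ax0.
pose A' := A1 - s^-1 *: (A1 *m x0) *m a^T.
pose b' := b - (dotv b x0 / s) *: a.
have [y y0 yE] : exists2 y, lev 0 y & A'^T *m y = b'.
  apply: IHm => x A'x; pose x' := x - (dotv a x / s) *: x0.
  have -> : dotv b' x = dotv b x'.
    by rewrite /b' /x' dotvBl dotvBr dotvZl dotvZr; field; lra.
  apply: Ab.
    suff -> : A1 *m x' = A' *m x by [].
    rewrite /A' mulmxBl mulmxBr -!scalemxAl -[_ *m a^T *m x]mulmxA.
    rewrite [a^T *m x]mx11_scalar -/(dotv a x) mul_mx_scalar -scalemxAr.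
    by rewrite scalerA mulrC.
  by rewrite dotvBr dotvZr -/s divfK ?subrr ?gt_eqF.
pose t := (dotv b x0 - dotv y (A1 *m x0)) / s.
exists (col_mx (t%:M : 'cV_1) y).
  apply/(@lev_0col_mx _ 1 m); split=> // i.
  rewrite ord1 !mxE eqxx mulr1n divr_ge0 ?(ltW ax0)//.
  have := lev_dotv y0 A1x0; rewrite {2}/dotv mulmx0 [X in _ <= X]mxE; lra.
rewrite (@tr_col_mx _ 1 m) (@mul_row_col _ n 1 m) trmxK mul_mx_scalar.
have -> : A1^T *m y = A'^T *m y + (dotv y (A1 *m x0) / s) *: a.
  rewrite /A' linearB /= mulmxBl trmx_mul trmxK -mulmxA.
  rewrite [(_ *: _)^T *m y]mx11_scalar -/(dotv _ y) mul_mx_scalar.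
  by rewrite dotvZl [dotv _ y]dotvC [X in X *: a]mulrC subrK.
rewrite addrC yE -addrA -scalerDl -mulrDl [dotv y _ + _]addrC.
by rewrite !subrK.
Qed.

(** The inequalities are homogenized with a scale [t >= 0].  A solution
    [(x, t)] of the homogeneous system is added to the feasible point [x0] (of
    scale 1) with an arbitrarily large weight [s]: rescaling the sum to scale 1
    gives a feasible point, so [dotv c x - delta * t] cannot be positive. *)
Lemma affine_farkas (R : realType) m n (A : 'M[R]_(m, n)) b c delta x0 :
  lev (A *m x0) b -> (forall x, lev (A *m x) b -> dotv c x <= delta) ->
  exists y, [/\ lev 0 y, A^T *m y = c & dotv y b <= delta].
Proof.
move=> Ax0 Ac.
have [] := @farkas R (m + 1) (n + 1) (block_mx A (- b) 0 (- 1%:M))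
  (col_mx c (- delta)%:M).
  move=> x; rewrite -(vsubmxK x); move: (usubmx x) (dsubmx x) => {}x t.
  rewrite [t]mx11_scalar; move: (t 0 0) => {}t.
  rewrite mul_block_col mul0mx add0r !mulNmx mul1mx mul_mx_scalar.
  move=> /lev_col_mx0[Axt /(_ 0)]; rewrite !mxE eqxx mulr1n oppr_le0 => t0.
  rewrite dotv_col_mx [dotv (_%:M) _]dotvE big_ord1 !mxE eqxx !mulr1n mulNr.
  rewrite leNgt; apply/negP => w0; set w := _ - _ in w0.
  (* With this weight, [dotv c x0 + s * w] exceeds [delta] by 1. *)
  pose s := (delta - dotv c x0 + 1) / w.
  have cx0 := Ac _ Ax0.
  have s0 : 0 <= s by rewrite divr_ge0 ?(ltW w0)//; lra.
  have st0 : 0 < 1 + s * t by have := mulr_ge0 s0 t0; lra.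
  have /Ac : lev (A *m ((1 + s * t)^-1 *: (x0 + s *: x))) b.
    move=> i; rewrite -scalemxAr mxE mulrC ler_pdivrMr// mulmxDr -scalemxAr.
    have := Axt i; rewrite !mxE => /(ler_wpM2l s0); have := Ax0 i.
    by rewrite !mxE; nra.
  rewrite dotvZr mulrC ler_pdivrMr// dotvDr dotvZr.
  have sw : s * w = delta - dotv c x0 + 1 by rewrite /s divfK ?gt_eqF.
  by move: sw; rewrite /w; nra.
move=> y; rewrite -(vsubmxK y); move: (usubmx y) (dsubmx y) => {}y t.
move=> /lev_0col_mx[y0 /(_ 0)]; rewrite mxE => t0.
rewrite tr_block_mx mul_block_col trmx0 mul0mx addr0 => /eq_col_mx[yE].
rewrite !linearN /= mulNmx trmx1 mulNmx mul1mx => /matrixP/(_ 0 0).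
rewrite [LHS]mxE [X in X + _]mxE [X in _ + X]mxE [RHS]mxE eqxx mulr1n.
rewrite -/(dotv b y) dotvC => e.
by exists y; split=> //; lra.
Qed.

(** * Linear programs penalized by the 1-norm *)

(** The 1-norm is the least sum of entries of a [u] with [z <= u] and
    [- z <= u], so the hypothesis bounds the linear program in [(z, u)] with
    objective [dotv a z - t * \sum_i u i 0].  If [al] and [be] are the
    multipliers of the two families of additional inequalities, then
    [H^T *m p - a = be - al] and [al + be] is constant equal to [t]. *)
Lemma norm1_lp_duality (R : realType) nh nz (H : 'M[R]_(nh, nz)) h a t b z0 :
  Zset H h z0 -> 0 <= t ->
  (forall z, Zset H h z -> dotv a z - t * norm1 z <= b) ->
  exists p, [/\ lev 0 p, forall j, `|(H^T *m p - a) j 0| <= t & dotv p h <= b].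
Proof.
move=> Hz0 t0 Hab.
pose A : 'M[R]_(nh + (nz + nz), nz + nz) :=
  col_mx (row_mx H 0)
    (col_mx (row_mx 1%:M (- 1%:M)) (row_mx (- 1%:M) (- 1%:M))).
have AE z u : A *m col_mx z u = col_mx (H *m z) (col_mx (z - u) (- z - u)).
  by rewrite !mul_col_mx !mul_row_col mul0mx addr0 !mulNmx !mul1mx.
pose b' : 'cV[R]_(nh + (nz + nz)) := col_mx h 0.
pose absv (z : 'cV[R]_nz) : 'cV[R]_nz := \col_i `|z i 0|.
have feas : lev (A *m col_mx z0 (absv z0)) b'.
  rewrite AE; apply/lev_col_mx; split=> //.
  apply/lev_col_mx0; split=> i; rewrite !mxE subr_le0 ?ler_norm//.
  by rewrite -normrN ler_norm.
have [|y [y0 yE yb]] :=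
    @affine_farkas R _ _ A b' (col_mx a (const_mx (- t))) b _ feas.
  move=> x; rewrite -(vsubmxK x); move: (usubmx x) (dsubmx x) => {x} z u.
  rewrite AE => /lev_col_mx[Hz /lev_col_mx0[zu nzu]].
  apply: le_trans (Hab z Hz); rewrite dotv_col_mx lerD2l dotvE.
  rewrite /norm1 -mulNr mulr_sumr; apply: ler_sum => i _; rewrite mxE.
  apply: ler_wnM2l; first by rewrite oppr_le0.
  have := zu i; have := nzu i; rewrite !mxE ler_norml => *.
  by apply/andP; split; lra.
move: y0 yE yb; rewrite -(vsubmxK y); move: (usubmx y) (dsubmx y) => {}y y2.
rewrite -(vsubmxK y2); move: (usubmx y2) (dsubmx y2) => {y2} al be.
move=> /lev_0col_mx[y0 /lev_0col_mx[al0 be0]].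
rewrite !tr_col_mx !tr_row_mx !mul_row_col !mul_col_mx !add_col_mx.
rewrite !linearN /= trmx0 trmx1 !mulNmx !mul1mx mul0mx add0r.
move=> /eq_col_mx[yE abE] yb; exists y; split=> //; last first.
  by move: yb; rewrite /b' dotv_col_mx [dotv _ 0]/dotv mulmx0 mxE addr0.
move=> j; have := al0 j; have := be0 j.
move/matrixP/(_ j 0): abE; rewrite -yE !mxE => e b0 a0.
by rewrite ler_norml; apply/andP; split; lra.
Qed.

(** * From primal to dual certificates *)

Theorem theorem6 (R : realType) (nx ny nf nz nh : nat)
    (X : set 'cV[R]_nx) (c : 'cV[R]_nx) (d : 'cV[R]_ny)
    (B : 'M[R]_(nf, ny))
    (f : 'cV[R]_nx -> 'cV[R]_nf) (F : 'cV[R]_nx -> 'M[R]_(nf, nz))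
    (H : 'M[R]_(nh, nz)) (h : 'cV[R]_nh)
    (f_affine : is_affine f) (F_affine : is_affine F)
    (h_ge0 : lev 0 h)
    (Hcomplete : complete_recourse B) (Hbounded : bounded_recourse B d) :
  YbarP X c d B f F H h `<=` YbarD X c d B f F H h.
Proof.
move=> [[x v] k] /= [Xx k0 [q [Q [qd [cost rec kqd Bqd]]]]]; split=> //.
have Z0 : Zset H h 0 by rewrite /Zset /= mulmx0.
have [z Zz|pi [pi0 piH pih]] := @norm1_lp_duality R _ _ H h (Q^T *m d)
    (k - dotv d qd) (v - dotv c x - dotv d q) 0 Z0 kqd.
  by have := cost z Zz; rewrite !dotvDr dotvZr dotv_mulmx; lra.
pose G := F x - B *m Q.
have row_cert i : exists p, [/\ lev 0 p,
    forall j, `|(H^T *m p - (row i G)^T) j 0| <= (B *m qd) i 0 &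
    dotv p h <= (B *m q - f x) i 0].
  apply: (norm1_lp_duality Z0); first by have := Bqd i; rewrite mxE.
  move=> z Zz; have := rec z Zz i.
  rewrite -dotv_row /G mulmxBl !mulmxDr -scalemxAr mulmxA !mxE.
  by lra.
have [P PE] := choice row_cert.
pose Pi := \matrix_(j, i) P i j 0 : 'M[R]_(nh, nf).
have colPi i : (row i Pi^T)^T = P i by apply/colP => j; rewrite !mxE.
exists pi, Pi; split=> rho [rho0 rhoB].
- have : dotv (Pi *m rho) h <= dotv rho (B *m q - f x).
    rewrite dotvC dotv_mulmx dotvC; apply: lev_dotv => // i.
    by rewrite dotv_row colPi; have [] := PE i.
  by rewrite dotvBr dotv_mulmx rhoB dotvDl; lra.
- set w := _ - (F x)^T *m rho; suff wk j : `|w j 0| <= k.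
    by split=> j; have := wk j; rewrite ler_norml => /andP[]; rewrite !mxE.
  have -> : w = (H^T *m pi - Q^T *m d) + (H^T *m Pi - G^T) *m rho.
    rewrite /w /G linearB /= trmx_mul mulmxDr !mulmxBl -mulmxA.
    rewrite -[Q^T *m B^T *m rho]mulmxA rhoB opprB [_ - (F x)^T *m _]addrC.
    by rewrite addrACA addrA; apply/matrixP => ? ?; rewrite !mxE; ring.
  have : `|((H^T *m Pi - G^T) *m rho) j 0| <= dotv rho (B *m qd).
    rewrite mxE dotvE; apply: le_trans (ler_norm_sum _ _ _) _.
    apply: ler_sum => i _; have := rho0 i; rewrite mxE => ri0.
    rewrite normrM (ger0_norm ri0) mulrC ler_wpM2l//.
    have [_ /(_ j) + _] := PE i; rewrite !mxE; congr (`|_ - _| <= _).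
    by apply: eq_bigr => l _; rewrite !mxE.
  rewrite dotv_mulmx rhoB => tol; rewrite mxE.
  by apply: le_trans (ler_normD _ _) _; have := piH j; lra.
- move=> i; have := pi0 i; rewrite !mxE => pi_ge0.
  apply: addr_ge0 => //; apply: sumr_ge0 => l _; rewrite mxE mulr_ge0//.
    by have [/(_ i) + _ _] := PE l; rewrite mxE.
  by have := rho0 l; rewrite mxE.
Qed.
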